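(* Let $T$ be a bounded subset of $\mathbb R^p$. Let $\mathbf B$ be an $n\times q$ random matrix with i.i.d. $\mathcal N(0,1)$ entries and let $\mathbf A=\mathbf B\mathbf C$, where $\mathbf C$ is a deterministic $q\times p$ matrix. Fix $\varepsilon\ge0$ and let $T_\varepsilon:=\{\mathbf u\in T:\ \frac1n\|\mathbf A\mathbf u\|_1\le\varepsilon\}$. Then $$\mathbb E\sup_{\mathbf u\in T_\varepsilon}\left(\mathbf u^T\mathbf C^T\mathbf C\mathbf u\right)^{1/2}\le\sqrt{\frac{2\pi}{n}}\ \mathbb E\sup_{\mathbf u\in T}|\langle\mathbf C^T\mathbf g,\mathbf u\rangle|+\sqrt{\frac\pi2}\,\varepsilon,$$ where $\mathbf g\sim\mathcal N(0,\mathbf I_q)$ is a standard Gaussian random vector in $\mathbb R^q$. *)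

(* Defs.v *)
From HB Require Import structures.
From mathcomp Require Import all_boot all_order all_algebra.
From mathcomp Require Import all_classical all_reals all_analysis.
Set Implicit Arguments. Unset Strict Implicit. Unset Printing Implicit Defensive.
Import Order.TTheory GRing.Theory Num.Theory.
Import numFieldNormedType.Exports.
Local Open Scope classical_set_scope.
Local Open Scope ring_scope.

(* A finite family (X i)_{i in I} of real random variables on (Omega, P) is an
   i.i.d. family of standard Gaussians N(0,1): each X i is measurable, has law
   N(0,1), and the family is mutually independent (product rule for every
   family of measurable sets; taking A i = setT recovers every subfamily). *)
Definition iid_std_gaussian {R : realType} {d : measure_display}
  {Omega : measurableType d} (P : probability Omega R) (I : finType)
  (X : I -> Omega -> R) : Prop :=
  [/\ (forall i, measurable_fun setT (X i)),
      (forall i (A : set R), measurable A ->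
          P (X i @^-1` A) = normal_prob 0 1 A) &
      (forall A : I -> set R, (forall i, measurable (A i)) ->
          P (\bigcap_(i in [set: I]) (X i @^-1` A i)) =
          (\prod_(i : I) P (X i @^-1` A i))%E)].

Definition l1norm {R : realType} (m : nat) (v : 'cV[R]_m) : R :=
  \sum_(i < m) `|v i ord0|.

(* supremum of a set of (nonnegative) reals in \bar R, with sup of the empty
   set taken to be 0 *)
Definition sup_or0 {R : realType} (S : set R) : \bar R :=
  ereal_sup (0%E |` [set x%:E | x in S]).

(* Main.v *)
(* For a standard Gaussian vector b one has E |<b, y>| = sqrt (2 / pi) |y|, so
   sqrt (2 / pi) |C u| exceeds |A u|_1 / n by (1 / n) sum_i Z_i(u), where
   Z_i(u) = sqrt (2 / pi) |C u| - |<b_i, C u>|, and it suffices to bound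
   E sup_u sum_i Z_i(u) by 2 sqrt n * E sup_u <g, C u>. The rows are treated
   one at a time: with h denoting the contribution of the other rows, convexity
   of the supremum, Jensen's inequality for an independent copy of the row, the
   contraction inequality for a symmetric sign and the symmetry of b give
     E sup (h + sqrt (2 / pi) |y| - |<b, y>|) <= E sup (h + 2 <b, y>).
   Finally (b_1 + ... + b_n) / sqrt n is again a standard Gaussian vector.
   Suprema over T are limits of maxima over finite subsets of a countable dense
   subset of T, to which 0 may be added.

   Independence is only used through the uniqueness of the joint law of an
   i.i.d. Gaussian family: any part of the family may be replaced by an
   independent copy living on a product space, where Tonelli applies. *)

Require Import Defs.
From HB Require Import structures.
From mathcomp Require Import all_boot all_order all_algebra.
From mathcomp Require Import all_classical all_reals all_analysis.
From mathcomp Require Import measurable_realfun.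
From mathcomp Require Import ring lra.
Set Implicit Arguments. Unset Strict Implicit. Unset Printing Implicit Defensive.
Import Order.TTheory GRing.Theory Num.Theory.
Import numFieldNormedType.Exports.
Local Open Scope classical_set_scope.
Local Open Scope ring_scope.

(** * Integration on nonnegative functions *)

Section nonnegative_integral.
Local Open Scope ereal_scope.
Context d (T : measurableType d) (R : realType).
Import HBNNSimple.

(* The integral of a nonnegative function is the supremum of the integrals of
   the simple functions below it, so it is monotone without any measurability;
   the supremum over the random set in the theorem need not be measurable. *)
Lemma ge0_le_integral_nomeas (mu : {measure set T -> \bar R}) (f g : T -> \bar R) :
  (forall x, 0 <= f x) -> (forall x, f x <= g x) ->
  \int[mu]_x f x <= \int[mu]_x g x.
Proof.
move=> f0 fg; have g0 x : 0 <= g x by exact: le_trans (fg x).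
rewrite !ge0_integralTE//; apply: ereal_sup_le => _ [h /= hf <-].
by exists h => // x; exact: le_trans (fg x).
Qed.

(** For indicators this is the hypothesis on [nu]; linearity extends it to nonnegative simple
    functions, and monotone convergence along [nnsfun_approx] reaches [f]. *)
Lemma ge0_integral_density (mu nu : {measure set T -> \bar R}) (p : T -> R) :
  (forall x, 0 <= p x)%R -> measurable_fun setT p ->
  (forall A, measurable A -> nu A = \int[mu]_(x in A) (p x)%:E) ->
  forall f : T -> \bar R, measurable_fun setT f -> (forall x, 0 <= f x) ->
  \int[nu]_x f x = \int[mu]_x (f x * (p x)%:E).
Proof.
move=> p0 mp nuE f mf f0.
have mpE : measurable_fun setT (EFin \o p) by exact/measurable_EFinP.
have indicE_ E : measurable E ->
    \int[nu]_x (\1_E x)%:E = \int[mu]_x ((\1_E x)%:E * (p x)%:E).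
  move=> mE; rewrite integral_indic// setIT nuE// integral_mkcond.
  apply: eq_integral => x _; rewrite patchE indicE.
  by case: (x \in E); rewrite ?mul1e ?mul0e.
have nnsfunE (h : {nnsfun T >-> R}) :
    \int[nu]_x (h x)%:E = \int[mu]_x ((h x)%:E * (p x)%:E).
  under [LHS]eq_integral do rewrite fimfunE -fsumEFin//.
  rewrite [LHS]ge0_integral_fsum//; last 2 first.
    by move=> r; exact/measurable_EFinP/measurableT_comp.
    by move=> r x _; rewrite EFinM nnfun_muleindic_ge0.
  under [RHS]eq_integral.
    move=> x _; rewrite muleC fimfunE -fsumEFin// ge0_mule_fsumr; last first.
      by move=> r; rewrite EFinM nnfun_muleindic_ge0.
    over.
  rewrite [RHS]ge0_integral_fsum//; last 2 first.
    move=> r; apply: emeasurable_funM => //.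
    exact/measurable_EFinP/measurableT_comp.
    move=> r x _; apply: mule_ge0; first by rewrite lee_fin.
    by rewrite EFinM nnfun_muleindic_ge0.
  apply: eq_fsbigr => r _.
  rewrite integralZl_indic_nnsfun// indicE_//.
  (* A nonnegative simple function omits every value [r < 0], so such terms vanish on both sides. *)
  have [r0|r0] := leP 0%R r; last first.
    rewrite preimage_nnfun0// integral0_eq; last first.
      by move=> x _; rewrite indicE in_set0 mul0e.
    by rewrite mule0 integral0_eq// => x _; rewrite indicE in_set0 mulr0 mule0.
  rewrite -ge0_integralZl//.
  - by apply: eq_integral => x _; rewrite EFinM [RHS]muleC -muleA.
  - apply: emeasurable_funM => //; exact/measurable_EFinP/measurable_indic.
  - by move=> x _; rewrite mule_ge0// lee_fin.
pose h := nnsfun_approx measurableT mf.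
transitivity (limn (fun n => \int[nu]_x (h n x)%:E)).
  rewrite -monotone_convergence//=.
  - apply: eq_integral => x _; apply/esym/cvg_lim => //=.
    exact: cvg_nnsfun_approx.
  - by move=> n; exact/measurable_EFinP.
  - by move=> n x _; rewrite lee_fin.
  - by move=> x _ a b ab; rewrite lee_fin; exact/lefP/nd_nnsfun_approx.
rewrite (_ : (fun n => _) = (fun n => \int[mu]_x ((h n x)%:E * (p x)%:E))); last first.
  by apply/funext => n; exact: nnsfunE.
rewrite -monotone_convergence//=.
- apply: eq_integral => x _; apply/cvg_lim => //=.
  by apply: cvgeZr => //; exact: cvg_nnsfun_approx.
- by move=> n; apply: emeasurable_funM => //; exact/measurable_EFinP.
- by move=> n x _; rewrite mule_ge0// lee_fin.
- move=> x _ a b ab; rewrite lee_wpmul2r ?lee_fin//.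
  exact/lefP/nd_nnsfun_approx.
Qed.

End nonnegative_integral.

(** * Affine substitution in the Lebesgue integral *)

Section affine_change_of_variable.
Local Open Scope ereal_scope.
Context {R : realType}.
Notation mu := (@lebesgue_measure R).

Lemma ge0_integral_lebesgue_affine (a b : R) (f : R -> \bar R) : a != 0%R ->
  measurable_fun setT f -> (forall x, 0 <= f x) ->
  \int[mu]_x f x = `|a|%:E * \int[mu]_x f (a * x + b)%R.
Proof.
move=> a0 mf f0.
pose phi x : measurableTypeR R := (a * x + b)%R.
have mphi : measurable_fun setT phi.
  by apply: measurable_funD => //; exact: measurable_funM.
pose m : {measure set (measurableTypeR R) -> \bar R} :=
  measure_function_pushforward__canonical__measure_function_Measure mu mphi.
pose k : {nonneg R} := NngNum (normr_ge0 a).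
(* By uniqueness of Lebesgue measure it suffices to compare half-open intervals. A negative slope
   moves the closed end to the left, which does not change the length. *)
have muE : forall A : set (measurableTypeR R), measurable A -> mu A = mscale k m A.
  apply: lebesgue_measure_unique => _ [[u v] _ <-].
  rewrite -[RHS]/(`|a|%:E * mu (phi @^-1` `]u, v])).
  have [a_gt0|a_lt0|/eqP] := ltgtP 0%R a; last by rewrite eq_sym (negbTE a0).
  - rewrite (_ : phi @^-1` _ = `]((u - b) / a)%R, ((v - b) / a)%R]%classic); last first.
      apply/seteqP; split => x; rewrite /phi/= !in_itv/= => /andP[h1 h2]; apply/andP.
        by rewrite ltr_pdivrMr// ler_pdivlMr//; split; lra.
      by move: h1 h2; rewrite ltr_pdivrMr// ler_pdivlMr// => h1 h2; split; lra.
    rewrite !lebesgue_measure_itv/= !lte_fin ltr_pM2r ?invr_gt0// ltrD2r.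
    case: ifP; rewrite ?mule0// => _; rewrite -!EFinB -EFinM gtr0_norm//; congr EFin.
    by field.
  - rewrite (_ : phi @^-1` _ = `[((v - b) / a)%R, ((u - b) / a)%R[%classic); last first.
      apply/seteqP; split => x; rewrite /phi/= !in_itv/= => /andP[h1 h2]; apply/andP.
        by rewrite ler_ndivrMr// ltr_ndivlMr//; split; lra.
      by move: h1 h2; rewrite ler_ndivrMr// ltr_ndivlMr// => h1 h2; split; lra.
    rewrite !lebesgue_measure_itv/= !lte_fin ltr_nM2r ?invr_lt0// ltrD2r.
    case: ifP; rewrite ?mule0// => _; rewrite -!EFinB -EFinM ltr0_norm//; congr EFin.
    by field.
rewrite (@eq_measure_integral _ _ _ _ (mscale k m)); last by move=> A mA _; exact: muE.
rewrite ge0_integral_mscale//= ge0_integral_pushforward//.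
Qed.

End affine_change_of_variable.

(** * One-dimensional Gaussian integrals *)

Section gaussian_algebra.
Context {F : realFieldType}.
Implicit Types a b c s w x y z : F.

Lemma gaussian_exponent_scale a x : a != 0 ->
  - (a ^+ 2 * x ^+ 2) / (a ^+ 2 *+ 2) = - x ^+ 2 / (1 *+ 2).
Proof. by move=> a0; field. Qed.

(** Completion of the square in [y], with [w] the total variance and [w - s ^+ 2] the variance of
    the other summand. *)
Lemma gaussian_exponent_conv s w y z : w != 0 -> w - s ^+ 2 != 0 ->
  - (z - s * y) ^+ 2 / ((w - s ^+ 2) *+ 2) + - y ^+ 2 / (1 *+ 2) =
  - z ^+ 2 / (w *+ 2) +
  - (y - s * z / w) ^+ 2 / ((w - s ^+ 2) / w *+ 2).
Proof. by move=> w0 w20; field; apply/andP. Qed.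

Lemma gaussian_peak_conv a b c : a != 0 -> b != 0 -> c != 0 ->
  (a * c)^-1 / c = (b * c)^-1 / (a / b * c).
Proof. by move=> a0 b0 c0; field; apply/and3P. Qed.

End gaussian_algebra.

Section gaussian_integrals.
Context {R : realType}.
Notation mu := (@lebesgue_measure R).
Notation gauss := (@normal_prob R 0 1).

Lemma normal_peakE (s : R) : normal_peak s = (`|s| * Num.sqrt (2 * pi))^-1.
Proof.
rewrite /normal_peak -mulr_natl mulrCA sqrtrM ?sqr_ge0// sqrtr_sqr.
by [].
Qed.

Lemma normal_pdf_affine (a b x : R) : a != 0 ->
  `|a| * normal_pdf b a (a * x + b) = normal_pdf 0 1 x.
Proof.
move=> a0; rewrite !normal_pdfE ?oner_eq0// !normal_peakE /normal_fun.
rewrite addrK subr0 normr1 mul1r mulrA; congr (_ * expR _).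
  by rewrite invfM mulrA divff ?normr_eq0// mul1r.
by rewrite expr1n exprMn gaussian_exponent_scale.
Qed.

(** The joint density of [y] and [z = a x + s y] is factored in two ways: [y] first and then [z]
    given [y], or [z] first and then [y] given [z], the latter having mean [s * z / r ^+ 2] and
    deviation [a / r]. *)
Lemma normal_pdf_conv (a s r y z : R) : a != 0 -> r != 0 ->
  r ^+ 2 = a ^+ 2 + s ^+ 2 ->
  normal_pdf (s * y) a z * normal_pdf 0 1 y =
  normal_pdf 0 r z * normal_pdf (s * z / r ^+ 2) (a / r) y.
Proof.
move=> a0 r0 rE.
rewrite !normal_pdfE ?oner_eq0 ?mulf_neq0 ?invr_eq0// !normal_peakE.
rewrite mulrACA [RHS]mulrACA; congr (_ * _).
  rewrite normr1 mul1r normrM normfV.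
  have ? : `|r| != 0 by rewrite normr_eq0.
  have ? : `|a| != 0 by rewrite normr_eq0.
  have ? : Num.sqrt (2 * pi) != 0 :> R.
    by rewrite gt_eqF// sqrtr_gt0 mulr_gt0// pi_gt0.
  exact: gaussian_peak_conv.
rewrite /normal_fun -!expRD !subr0; congr expR.
have r20 : r ^+ 2 != 0 by rewrite sqrf_eq0.
have a2E : a ^+ 2 = r ^+ 2 - s ^+ 2 by rewrite rE addrK.
have a20 : r ^+ 2 - s ^+ 2 != 0 by rewrite -a2E sqrf_eq0.
by rewrite expr1n expr_div_n a2E gaussian_exponent_conv.
Qed.

Lemma measurable_fun_normal_pdf2 (s a : R) : a != 0 ->
  measurable_fun [set: R * R] (fun x => normal_pdf (s * x.1) a x.2).
Proof.
move=> a0.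
rewrite (_ : (fun _ => _) = (fun x : R * R => normal_peak a *
  expR (- (x.2 - s * x.1) ^+ 2 / (a ^+ 2 *+ 2)))); last first.
  by apply/funext => x; rewrite normal_pdfE.
apply: measurable_funM => //; apply: measurableT_comp => //.
apply: measurable_funM => //; apply: measurableT_comp => //.
apply: measurable_funX; apply: measurable_funB => //.
by apply: measurable_funM.
Qed.

Local Open Scope ereal_scope.

Lemma ge0_integral_normal (f : R -> \bar R) m s : measurable_fun setT f ->
  (forall x, 0 <= f x) ->
  \int[normal_prob m s]_x f x = \int[mu]_x (f x * (normal_pdf m s x)%:E).
Proof.
move=> mf f0; apply: ge0_integral_density => //.
- exact: normal_pdf_ge0.
- exact: measurable_normal_pdf.
Qed.

Lemma ge0_integral_gauss_affine (f : R -> \bar R) (a b : R) : a != 0%R ->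
  measurable_fun setT f -> (forall x, 0 <= f x) ->
  \int[gauss]_x f (a * x + b)%R = \int[mu]_z (f z * (normal_pdf b a z)%:E).
Proof.
move=> a0 mf f0.
have maff : measurable_fun [set: R] (fun x => a * x + b)%R.
  by apply: measurable_funD => //; exact: measurable_funM.
have mpdf m s : measurable_fun [set: R] (fun x => (normal_pdf m s x)%:E).
  by apply/measurable_EFinP; exact: measurable_normal_pdf.
have mfaff : measurable_fun [set: R] (fun x => f (a * x + b)%R).
  exact: measurableT_comp.
rewrite (ge0_integral_normal 0 1 mfaff (fun=> f0 _)).
rewrite [RHS](ge0_integral_lebesgue_affine b a0); first last.
- by move=> x; rewrite mule_ge0// lee_fin normal_pdf_ge0.
- exact: emeasurable_funM.
rewrite -ge0_integralZl//.
- by apply: eq_integral => x _; rewrite -(normal_pdf_affine b x a0) EFinM muleCA.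
- apply: emeasurable_funM; first exact: measurableT_comp.
  exact: measurableT_comp (mpdf _ _) _.
- by move=> x _; rewrite mule_ge0// lee_fin normal_pdf_ge0.
Qed.

(** A sum of independent centred Gaussians is Gaussian with added variances: Tonelli puts the
    integral over [y] inside, where the conditional density of [normal_pdf_conv] has total mass
    1. *)
Lemma gauss_stable (f : R -> \bar R) (a s : R) :
  measurable_fun setT f -> (forall x, 0 <= f x) ->
  \int[gauss]_y \int[gauss]_x f (a * x + s * y)%R =
  \int[gauss]_z f (Num.sqrt (a ^+ 2 + s ^+ 2) * z)%R.
Proof.
move=> mf f0; set r := Num.sqrt _.
have r2 : (r ^+ 2 = a ^+ 2 + s ^+ 2)%R.
  by rewrite sqr_sqrtr// addr_ge0 ?sqr_ge0.
have mpdf m t : measurable_fun [set: R] (fun x => (normal_pdf m t x)%:E).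
  by apply/measurable_EFinP; exact: measurable_normal_pdf.
(* When [a = 0], the variable [a x + s y] given [y] has no density, so this case is separate; there
   [r] is the absolute value of [s], and the centred normal density is even in its deviation. *)
have [a0|a0] := eqVneq a 0%R.
  have cstE (c : \bar R) : \int[gauss]_x c = c.
    rewrite integral_cst//= -[RHS]mule1; congr *%E.
    exact: (@probability_setT _ _ _ gauss).
  transitivity (\int[gauss]_y f (s * y)%R).
    apply: eq_integral => y _; rewrite -[RHS]cstE.
    by apply: eq_integral => x _; rewrite a0 mul0r add0r.
  rewrite /r a0 expr0n/= add0r sqrtr_sqr.
  have [s0|s0] := eqVneq s 0%R; first by rewrite s0 normr0.
  have s'0 : `|s|%R != 0%R by rewrite normr_eq0.
  have := ge0_integral_gauss_affine 0 s0 mf f0.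
  have := ge0_integral_gauss_affine 0 s'0 mf f0.
  under eq_integral do rewrite addr0.
  move=> ->; under eq_integral do rewrite addr0.
  move=> ->; apply: eq_integral => z _.
  by rewrite !normal_pdfE// /normal_peak /normal_fun real_normK// num_real.
have r0 : r != 0%R.
  by rewrite -sqrf_eq0 r2 paddr_eq0 ?sqr_ge0// sqrf_eq0 (negbTE a0).
pose F (x : R * R) := f x.2 * (normal_pdf (s * x.1) a x.2 * normal_pdf 0 1 x.1)%:E.
have mF : measurable_fun setT F.
  apply: emeasurable_funM; first exact: measurableT_comp.
  apply/measurable_EFinP; apply: measurable_funM.
    exact: measurable_fun_normal_pdf2.
  by apply: measurableT_comp => //; exact: measurable_normal_pdf.
have F0 x : 0 <= F x.
  by rewrite mule_ge0// lee_fin mulr_ge0 ?normal_pdf_ge0.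
have mG : measurable_fun [set: R] (fun y => \int[gauss]_x f (a * x + s * y)%R).
  pose G (x : R * R) := f (a * x.2 + s * x.1)%R.
  have mG : measurable_fun setT G.
    by apply: measurableT_comp => //; apply: measurable_funD; exact: measurable_funM.
  exact: (@measurable_fun_fubini_tonelli_F _ _ _ _ _ gauss G mG (fun=> f0 _)).
rewrite (ge0_integral_normal 0 1 mG); last by move=> y; exact: integral_ge0.
transitivity (\int[mu]_y \int[mu]_z F (y, z)).
  apply: eq_integral => y _; rewrite ge0_integral_gauss_affine//.
  rewrite -ge0_integralZr//.
  - by apply: eq_integral => z _; rewrite /F/= EFinM muleA.
  - by apply: emeasurable_funM => //; exact: mpdf.
  - by move=> z _; rewrite mule_ge0// lee_fin normal_pdf_ge0.
  - by rewrite lee_fin normal_pdf_ge0.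
rewrite fubini_tonelli//.
have := ge0_integral_gauss_affine 0 r0 mf f0.
under eq_integral do rewrite addr0.
move=> ->; apply: eq_integral => z _; rewrite /F/=.
under eq_integral do rewrite (normal_pdf_conv _ _ a0 r0 r2) EFinM muleA.
rewrite ge0_integralZl//.
- by rewrite integral_normal_pdf mule1.
- exact: mpdf.
- by move=> y _; rewrite lee_fin normal_pdf_ge0.
- by rewrite mule_ge0// lee_fin normal_pdf_ge0.
Qed.

End gaussian_integrals.

Section gaussian_absolute_mean.
Context {R : realType}.
Notation mu := (@lebesgue_measure R).
Notation gauss := (@normal_prob R 0 1).
Local Open Scope ereal_scope.

(** By symmetry the mean is twice the integral of [x * p x] over the half-line. Since [- p] is a
    primitive vanishing at infinity, this is [2 * p 0]. *)
Lemma gauss_abs_mean : \int[gauss]_x (`|x|%R)%:E = (Num.sqrt (2 / pi))%:E.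
Proof.
pose p (x : R) := normal_pdf 0 1 x.
have pE x : p x = (normal_peak 1 * expR (- x ^+ 2 / 2))%R.
  by rewrite /p normal_pdfE ?oner_eq0// /normal_fun subr0 expr1n.
have cp : continuous p by apply: continuous_normal_pdf; rewrite oner_eq0.
rewrite ge0_integral_normal//; first last.
  by apply/measurable_EFinP; exact: normr_measurable.
under eq_integral do rewrite -EFinM.
rewrite (@ge0_symfun_integralT _ (fun x => `|x| * p x)%R); first last.
- by move=> x /=; rewrite normrN !pE sqrrN.
- move=> x; apply: (@continuousM _ _ (fun x : R => `|x|)%R p).
    exact: norm_continuous.
  exact: cp.
- by move=> x; rewrite mulr_ge0// normal_pdf_ge0.
rewrite -set_itvcy.
have dp (x : R) : is_derive x (1:R)%R (fun x => - p x)%R (x * p x)%R.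
  rewrite (_ : (fun x => - p x)%R =
      (fun x : R => - (normal_peak 1 * expR (- x ^+ 2 / 2)))%R); last first.
    by apply/funext => ?; rewrite pE.
  rewrite pE.
  apply: is_derive_eq.
  rewrite /GRing.scale/=.
  by set e := expR _; set k := normal_peak 1; field.
rewrite (@eq_integral _ _ _ mu _ (fun x => (x * p x)%:E)); last first.
  by move=> x; rewrite inE/= in_itv/= andbT => x0; rewrite ger0_norm.
rewrite (@ge0_continuous_FTC2y _ _ (fun x => - p x)%R 0%R 0%R).
- rewrite -EFinB -EFinM pE expr0n/= oppr0 mul0r expR0 mulr1 sub0r opprK.
  rewrite normal_peakE normr1 mul1r !sqrtrM// sqrtrV ?pi_ge0// -/(Num.sqrt _).
  have s2 : (Num.sqrt 2 * Num.sqrt 2 = 2 :> R)%R by rewrite -expr2 sqr_sqrtr.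
  have s20 : (Num.sqrt 2 != 0 :> R)%R by rewrite gt_eqF// sqrtr_gt0.
  by rewrite invfM mulrA -{1}s2 mulfK.
- by move=> x x0; rewrite mulr_ge0// normal_pdf_ge0.
- apply: continuous_subspaceT => x.
  by apply: (@continuousM _ _ id p) => //; exact: cp.
- rewrite -oppr0; apply: (@cvgN _ R^o); rewrite -(mulr0 (normal_peak 1)).
  rewrite (_ : p = (fun x => normal_peak 1 * expR (- (x ^+ 2 / 2)))%R); last first.
    by apply/funext => x; rewrite pE mulNr.
  apply: (@cvgM _ _ _ _ (cst (normal_peak 1)) (fun x : R => expR (- (x ^+ 2 / 2)))).
    exact: cvg_cst.
  apply: (cvg_comp (fun x : R => x ^+ 2 / 2)%R (fun x => expR (- x))%R);
    last exact: cvgr_expR.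
  by apply: gt0_cvgMly; rewrite ?invr_gt0//; exact: cvgr_expr2.
- by move=> x _; case: (dp x).
- apply: cvg_at_right_filter. apply: (@cvgN _ R^o). exact: cp.
- by move=> x _; rewrite derive1E; apply: derive_val.
Qed.

End gaussian_absolute_mean.

(** * The joint law of an i.i.d. Gaussian family *)

Section family_tuple.
Context {R : realType} {I : finType}.

Definition family_of_tuple (t : #|I|.-tuple R) (i : I) : R := tnth t (enum_rank i).

Definition tuple_of_family {S : Type} (X : I -> S -> R) (w : S) : #|I|.-tuple R :=
  [tuple X (enum_val k) w | k < #|I|].

Lemma tuple_of_familyK {S : Type} (X : I -> S -> R) w :
  family_of_tuple (tuple_of_family X w) = X ^~ w.
Proof. by apply/funext => i; rewrite /family_of_tuple tnth_mktuple enum_rankK. Qed.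

(* Functions on [I -> R] are measured through the Borel sigma-algebra of
   [#|I|.-tuple R]. *)
Definition family_measurable {d} {S : measurableType d} (F : (I -> R) -> S) :=
  measurable_fun setT (F \o family_of_tuple).

Lemma family_measurable_coord (i : I) : family_measurable (@^~ i).
Proof. exact: measurable_tnth. Qed.

Lemma measurable_tuple_of_family {d} {S : measurableType d} (X : I -> S -> R) :
  (forall i, measurable_fun setT (X i)) ->
  measurable_fun setT (tuple_of_family X).
Proof.
move=> mX; apply/measurable_fun_tnthP => k.
rewrite (_ : _ \o _ = X (enum_val k)); first exact: mX.
by apply/funext => w /=; rewrite tnth_mktuple.
Qed.

Lemma family_measurable_comp {d d'} {S : measurableType d} {V : measurableType d'}
    (X : I -> S -> R) (F : (I -> R) -> V) :
  (forall i, measurable_fun setT (X i)) -> family_measurable F ->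
  measurable_fun setT (fun w => F (X ^~ w)).
Proof.
move=> mX mF.
rewrite (_ : (fun _ => _) = (F \o family_of_tuple) \o tuple_of_family X).
  by apply: measurableT_comp => //; exact: measurable_tuple_of_family.
by apply/funext => w /=; rewrite tuple_of_familyK.
Qed.

Definition family_box (A : I -> set R) : set (#|I|.-tuple R) :=
  [set t | forall i, A i (family_of_tuple t i)].

Definition family_boxes : set (set (#|I|.-tuple R)) :=
  [set U | exists2 A : I -> set R, (forall i, measurable (A i)) & U = family_box A].

Lemma family_boxE (A : I -> set R) :
  family_box A = \bigcap_(i in [set: I]) ((@tnth _ R)^~ (enum_rank i) @^-1` A i).
Proof. by apply/seteqP; split => [t tA i _|t tA i]; exact: tA. Qed.

Lemma preimage_family_box {S : Type} (X : I -> S -> R) (A : I -> set R) :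
  tuple_of_family X @^-1` family_box A = \bigcap_(i in [set: I]) (X i @^-1` A i).
Proof.
apply/seteqP; split => [w wA i _|w wA i].
  by have := wA i; rewrite tuple_of_familyK.
by rewrite tuple_of_familyK; exact: wA.
Qed.

Lemma measurable_family_box (A : I -> set R) :
  (forall i, measurable (A i)) -> measurable (family_box A).
Proof.
move=> mA; rewrite family_boxE; apply: fin_bigcap_measurable => // i _.
by rewrite -[X in measurable X]setTI; exact: measurable_tnth.
Qed.

(** The preimage of a Borel set under one coordinate is a box whose other sides are [setT], so boxes
    generate the product sigma-algebra. *)
Lemma measurable_tupleE :
  @measurable _ (#|I|.-tuple R) = <<s family_boxes >>.
Proof.
apply/seteqP; split.
  apply: smallest_sub; first exact: smallest_sigma_algebra.
  move=> U; rewrite -bigcup_seq => -[k _ [B mB <-]].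
  apply: sub_sigma_algebra.
  exists (fun i => if i == enum_val k then B else setT).
    by move=> i; case: ifP.
  apply/seteqP; split => [t /= [_ tB] i|t /= tB].
    by case: eqP => // ->; rewrite /family_of_tuple enum_valK.
  by split => //; have := tB (enum_val k); rewrite eqxx /family_of_tuple enum_valK.
apply: smallest_sub; first exact: sigma_algebra_measurable.
by move=> U [A mA ->]; exact: measurable_family_box.
Qed.

End family_tuple.
Arguments family_of_tuple {R I}.
Arguments family_boxes : clear implicits.

Section product_probability.
Local Open Scope ereal_scope.
Context {d1 d2} {T1 : measurableType d1} {T2 : measurableType d2} {R : realType}.
Variables (P : probability T1 R) (Q : probability T2 R).

(** The product measure under a name of its own, to which the probability structure demanded by
    [iid_std_gaussian] is attached. *)
Definition prod_prob : set (T1 * T2) -> \bar R := P \x Q.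

HB.instance Definition _ := Measure.on prod_prob.

Let prod_prob_setT : prod_prob setT = 1.
Proof.
rewrite -setXTT [LHS]product_measure1E// -[RHS]mule1.
by congr (_ * _); exact: probability_setT.
Qed.

HB.instance Definition _ :=
  Measure_isProbability.Build _ _ _ prod_prob prod_prob_setT.

Lemma prod_probE A B : measurable A -> measurable B ->
  prod_prob (A `*` B) = P A * Q B.
Proof. exact: product_measure1E. Qed.

End product_probability.

(** * Uniqueness of the joint law and operations preserving it *)

Section iid_std_gaussian_theory.
Local Open Scope ereal_scope.
Context {R : realType} {I : finType}.
Notation gauss := (@normal_prob R 0 1).

Lemma gaussT : gauss [set: R] = 1.
Proof. exact: (@probability_setT _ _ _ gauss). Qed.

(** Marginal laws and independence merge into one product formula on boxes; the marginals come back
    by taking all sides but one equal to [setT]. *)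
Lemma iid_std_gaussian_boxP {d} {T : measurableType d} (P : probability T R)
    (X : I -> T -> R) :
  iid_std_gaussian P X <->
  (forall i, measurable_fun setT (X i)) /\
  (forall A : I -> set R, (forall i, measurable (A i)) ->
    P (\bigcap_(i in [set: I]) (X i @^-1` A i)) = \prod_(i : I) gauss (A i)).
Proof.
split=> [[mX lX iX]|[mX bX]].
  split => // A mA; rewrite iX//; apply: eq_bigr => i _; exact: lX.
have lX i (A : set R) : measurable A -> P (X i @^-1` A) = gauss A.
  move=> mA; pose B j := if j == i then A else setT.
  have mB j : measurable (B j) by rewrite /B; case: ifP.
  rewrite (_ : X i @^-1` A = \bigcap_(j in [set: I]) (X j @^-1` B j)).
    rewrite bX// (bigD1 i)//= big1 ?mule1.
      by rewrite /B eqxx.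
    by move=> j /negbTE ji; rewrite /B ji gaussT.
  apply/seteqP; split => [w /= wA j _|w /= wB].
    by rewrite /B /=; case: eqP => // ->.
  by have := wB i Logic.I; rewrite /B /= eqxx.
split => // A mA; rewrite bX//; apply: eq_bigr => i _; exact/esym/lX.
Qed.

(** Boxes generate the sigma-algebra and are stable under intersection, and both laws give a box the
    product of the Gaussian measures of its sides. *)
Lemma iid_std_gaussian_law {d d'} {T : measurableType d} {T' : measurableType d'}
    (P : probability T R) (Q : probability T' R)
    (X : I -> T -> R) (Y : I -> T' -> R) :
  iid_std_gaussian P X -> iid_std_gaussian Q Y ->
  forall U, measurable U ->
    P (tuple_of_family X @^-1` U) = Q (tuple_of_family Y @^-1` U).
Proof.
move=> /iid_std_gaussian_boxP[mX bX] /iid_std_gaussian_boxP[mY bY] U mU.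
have mtX := measurable_tuple_of_family mX.
have mtY := measurable_tuple_of_family mY.
pose PX := measure_function_pushforward__canonical__measure_function_Measure P mtX.
pose QY := measure_function_pushforward__canonical__measure_function_Measure Q mtY.
apply: (@measure_unique _ R _ (family_boxes R I) (fun=> setT) _ _ _ _ PX QY) => //.
- exact: measurable_tupleE.
- move=> _ _ [A mA ->] [B mB ->]; exists (fun i => A i `&` B i).
    by move=> i; exact: measurableI.
  apply/seteqP; split => [t [tA tB] i|t tAB].
    by split; [exact: tA|exact: tB].
  by split => i; have [] := tAB i.
- by move=> _; exists (fun=> setT) => //; apply/seteqP; split.
- by rewrite bigcup_const//; exists 0%N.
- move=> _ [A mA ->].
  rewrite -[LHS]/(P (tuple_of_family X @^-1` family_box A)).
  rewrite -[RHS]/(Q (tuple_of_family Y @^-1` family_box A)).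
  by rewrite !preimage_family_box bX// bY.
- move=> _; rewrite -[ltLHS]/(P (tuple_of_family X @^-1` setT)).
  by rewrite preimage_setT probability_setT ltry.
Qed.

Lemma iid_std_gaussian_expectation {d d'} {T : measurableType d}
    {T' : measurableType d'} (P : probability T R) (Q : probability T' R)
    (X : I -> T -> R) (Y : I -> T' -> R) (F : (I -> R) -> \bar R) :
  iid_std_gaussian P X -> iid_std_gaussian Q Y ->
  family_measurable F -> (forall x, 0 <= F x) ->
  \int[P]_w F (X ^~ w) = \int[Q]_w F (Y ^~ w).
Proof.
move=> iX iY mF F0.
have [mX _ _] := iX; have [mY _ _] := iY.
have mtX := measurable_tuple_of_family mX.
have mtY := measurable_tuple_of_family mY.
have pushE (d0 : measure_display) (S : measurableType d0)
    (M : probability S R) (Z : I -> S -> R) :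
    measurable_fun setT (tuple_of_family Z) ->
    \int[M]_w F (Z ^~ w) =
    \int[pushforward M (tuple_of_family Z)]_t (F \o family_of_tuple) t.
  move=> mZ; rewrite ge0_integral_pushforward//.
    by apply: eq_integral => w _ /=; rewrite tuple_of_familyK.
  by move=> t _; exact: F0.
rewrite (pushE _ _ _ _ mtX) (pushE _ _ _ _ mtY).
pose PX := measure_function_pushforward__canonical__measure_function_Measure P mtX.
pose QY := measure_function_pushforward__canonical__measure_function_Measure Q mtY.
apply: (@eq_measure_integral _ _ _ _ QY PX) => U mU _.
exact: (iid_std_gaussian_law iX iY mU).
Qed.

Lemma iid_std_gaussian_marginal {d} {T : measurableType d} (P : probability T R)
    (X : I -> T -> R) (i : I) (f : R -> \bar R) :
  iid_std_gaussian P X -> measurable_fun setT f -> (forall x, 0 <= f x) ->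
  \int[P]_w f (X i w) = \int[gauss]_x f x.
Proof.
move=> [mX lX _] mf f0.
(* [gauss] is a measure on [measurableTypeR R], whose display is not the one of
   the canonical structure on [R]. *)
pose PX : {measure set (measurableTypeR R) -> \bar R} :=
  measure_function_pushforward__canonical__measure_function_Measure P
    (mX i : measurable_fun setT (X i : T -> measurableTypeR R)).
transitivity (\int[PX]_x f x).
  exact/esym/(@ge0_integral_pushforward _ _ _ (measurableTypeR R) _ (X i) (mX i)
    P setT f measurableT mf (fun t _ => f0 t)).
apply: (@eq_measure_integral _ _ _ _ gauss PX) => A mA _.
exact: lX.
Qed.

(** Resampling: the coordinates in [K] come from the second factor, the others from the first. A box
    pulls back to a rectangle, whose measure is the required product. *)
Lemma iid_std_gaussian_mix {d d'} {T : measurableType d} {T' : measurableType d'}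
    (P : probability T R) (Q : probability T' R)
    (X : I -> T -> R) (Y : I -> T' -> R) (K : pred I) :
  iid_std_gaussian P X -> iid_std_gaussian Q Y ->
  iid_std_gaussian (prod_prob P Q)
    (fun i (z : T * T') => if K i then Y i z.2 else X i z.1).
Proof.
move=> /iid_std_gaussian_boxP[mX bX] /iid_std_gaussian_boxP[mY bY].
apply/iid_std_gaussian_boxP; split.
  by move=> i; case: (K i); apply: measurableT_comp.
move=> A mA.
pose AX i := if K i then setT else A i.
pose AY i := if K i then A i else setT.
have mAX i : measurable (AX i) by rewrite /AX; case: ifP.
have mAY i : measurable (AY i) by rewrite /AY; case: ifP.
rewrite (_ : \bigcap_(i in _) _ =
    (\bigcap_(i in [set: I]) (X i @^-1` AX i)) `*`
    (\bigcap_(i in [set: I]) (Y i @^-1` AY i))); last first.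
  apply/seteqP; split => [[u v] /= h|[u v] /= [hX hY] i _ /=].
    split => i _ /=; have := h i Logic.I; rewrite /AX /AY /=; by case: (K i).
  by have := hX i Logic.I; have := hY i Logic.I; rewrite /AX /AY /=; case: (K i).
rewrite [LHS]prod_probE; last 2 first.
- by apply: fin_bigcap_measurable => // i _; rewrite -[X in measurable X]setTI; exact: mX.
- by apply: fin_bigcap_measurable => // i _; rewrite -[X in measurable X]setTI; exact: mY.
rewrite bX// bY// -big_split/=; apply: eq_bigr => i _.
by rewrite /AX /AY; case: (K i); rewrite gaussT ?mule1 ?mul1e.
Qed.

Lemma gauss_opp (A : set R) : measurable A -> gauss (-%R @^-1` A) = gauss A.
Proof.
move=> mA.
have mNA : measurable (-%R @^-1` A : set R).
  by rewrite -[X in measurable X]setTI; exact: oppr_measurable.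
have := @ge0_integral_gauss_affine R (fun x => (\1_A x)%:E) (-1) 0.
have -> : \int[gauss]_x (\1_A (-1 * x + 0)%R)%:E = gauss (-%R @^-1` A).
  transitivity (\int[gauss]_x (\1_(-%R @^-1` A : set R) x)%:E).
    by apply: eq_integral => x _; rewrite addr0 mulN1r !indicE.
  by rewrite integral_indic// setIT.
move=> ->//.
- rewrite /normal_prob [RHS]integral_mkcond; apply: eq_integral => x _.
  rewrite patchE indicE; case: (x \in A); rewrite ?mul0e ?mul1e//.
  by rewrite !normal_pdfE ?oppr_eq0 ?oner_eq0// /normal_peak /normal_fun sqrrN.
- exact/measurable_EFinP/measurable_indic.
Qed.

Lemma iid_std_gaussian_flip {d} {T : measurableType d} (P : probability T R)
    (X : I -> T -> R) (K : pred I) :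
  iid_std_gaussian P X ->
  iid_std_gaussian P (fun i w => if K i then (- X i w)%R else X i w).
Proof.
move=> /iid_std_gaussian_boxP[mX bX]; apply/iid_std_gaussian_boxP; split.
  move=> i; case: (K i) => //; exact: measurableT_comp.
move=> A mA; pose B i := if K i then -%R @^-1` A i else A i.
have mB i : measurable (B i).
  rewrite /B; case: ifP => // _.
  by rewrite -[X in measurable X]setTI; exact: oppr_measurable.
rewrite (_ : \bigcap_(i in _) _ = \bigcap_(i in [set: I]) (X i @^-1` B i)); last first.
  by apply: eq_bigcapr => i _; rewrite /B; case: (K i).
rewrite bX//; apply: eq_bigr => i _; rewrite /B.
by case: ifP => // _; exact: gauss_opp.
Qed.

End iid_std_gaussian_theory.

(** * Linear images of Gaussian families *)

Section gaussian_linear_combination.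
Local Open Scope ereal_scope.
Context {R : realType}.
Notation gauss := (@normal_prob R 0 1).

Lemma probability_integral_cst {d} {T : measurableType d} (P : probability T R)
  (c : \bar R) : \int[P]_x c = c.
Proof.
rewrite integral_cst//= -[RHS]mule1; congr *%E; exact: probability_setT.
Qed.

(** Induction on [s]: one coordinate is resampled independently and integrated out by Tonelli, the
    induction hypothesis treats the remaining sum, and [gauss_stable] adds the variances. *)
Lemma iid_std_gaussian_linear {I : finType} {d} {T : measurableType d}
    (P : probability T R) (X : I -> T -> R) (a : I -> R) (s : seq I)
    (f : R -> \bar R) :
  iid_std_gaussian P X -> uniq s ->
  measurable_fun setT f -> (forall x, 0 <= f x) ->
  \int[P]_w f (\sum_(i <- s) a i * X i w)%R =
  \int[gauss]_z f (Num.sqrt (\sum_(i <- s) a i ^+ 2) * z)%R.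
Proof.
move=> iX; have [mX _ _] := iX.
elim: s f => [|i s IH] f /=.
  move=> _ mf f0; transitivity (\int[P]_w f 0%R).
    by apply: eq_integral => w _; rewrite big_nil.
  rewrite probability_integral_cst -[LHS](probability_integral_cst gauss).
  by apply: eq_integral => z _; rewrite big_nil sqrtr0 mul0r.
move=> /andP[nis us] mf f0.
pose F (x : I -> R) := f (a i * x i + \sum_(j <- s) a j * x j)%R.
have mlin (s' : seq I) : family_measurable (fun x : I -> R => \sum_(j <- s') a j * x j)%R.
  apply: measurable_sum => j.
  by apply: measurable_funM => //; exact: family_measurable_coord.
have mF : family_measurable F.
  apply: measurableT_comp => //; apply: measurable_funD; last exact: mlin.
  by apply: measurable_funM => //; exact: family_measurable_coord.
have iZ := iid_std_gaussian_mix (pred1 i) iX iX.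
transitivity (\int[P]_w F (X ^~ w)).
  by apply: eq_integral => w _; rewrite big_cons.
rewrite (iid_std_gaussian_expectation iX iZ mF (fun=> f0 _)).
pose W w := (\sum_(j <- s) a j * X j w)%R.
have mW : measurable_fun setT W.
  by apply: measurable_sum => j; by apply: measurable_funM.
pose G (z : T * T) := f (a i * X i z.2 + W z.1)%R.
have mG : measurable_fun setT G.
  apply: measurableT_comp => //; apply: measurable_funD.
    by apply: measurable_funM => //; exact: measurableT_comp.
  exact: measurableT_comp.
transitivity (\int[P \x P]_z G z).
  apply: eq_integral => z _; rewrite /F /G /W /= eqxx; congr (f (_ + _)%R).
  apply: eq_big_seq => j js; case: eqP => // ji.
  by move: nis; rewrite -ji js.
rewrite (fubini_tonelli1 G mG (fun=> f0 _)).
(* [g x] is the average over the resampled coordinate when the remaining sum equals [x]; the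
   induction hypothesis is applied to [g] in place of [f]. *)
pose g (x : R) := \int[gauss]_y f (a i * y + x)%R.
have mg : measurable_fun setT g.
  pose H (x : R * R) := f (a i * x.2 + x.1)%R.
  have mH : measurable_fun setT H.
    apply: measurableT_comp => //; apply: measurable_funD => //.
    by apply: measurable_funM.
  exact: (@measurable_fun_fubini_tonelli_F _ _ _ _ _ gauss H mH (fun=> f0 _)).
have g0 x : 0 <= g x by exact: integral_ge0.
transitivity (\int[P]_w g (W w)).
  apply: eq_integral => w _; rewrite /fubini_F /G /=.
  apply: (iid_std_gaussian_marginal (f := fun x => f (a i * x + W w)%R) i iX) => //.
  by apply: measurableT_comp => //; exact: measurable_funD.
rewrite (IH g us mg g0) /g gauss_stable//.
rewrite sqr_sqrtr; last by apply: sumr_ge0 => j _; exact: sqr_ge0.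
by apply: eq_integral => z _; rewrite big_cons.
Qed.

(** Each combination is standard because the weights have unit norm. Independence follows because
    distinct columns use disjoint sets of entries, which can be resampled one column at a time. *)
Lemma iid_std_gaussian_columns {I J : finType} {d} {T : measurableType d}
    (P : probability T R) (X : I * J -> T -> R) (a : I -> R) :
  iid_std_gaussian P X -> (\sum_i a i ^+ 2 = 1)%R ->
  iid_std_gaussian P (fun j w => \sum_i a i * X (i, j) w)%R.
Proof.
move=> iX a1; have [mX _ _] := iX.
pose Y (x : I * J -> R) j := (\sum_i a i * x (i, j))%R.
have mY j : family_measurable (Y ^~ j).
  apply: measurable_sum => i.
  by apply: measurable_funM => //; exact: family_measurable_coord.
have mYX j : measurable_fun setT (fun w => Y (X ^~ w) j).
  exact: family_measurable_comp (mY j).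
split.
- exact: mYX.
- move=> j A mA.
  have mYA : measurable ((fun w => Y (X ^~ w) j) @^-1` A).
    by rewrite -[X in measurable X]setTI; exact: mYX.
  transitivity (\int[P]_w (\1_A (Y (X ^~ w) j))%:E).
    rewrite [RHS](_ : _ = \int[P]_w (\1_((fun w => Y (X ^~ w) j) @^-1` A) w)%:E).
      by rewrite integral_indic// setIT.
    by apply: eq_integral => w _; rewrite !indicE.
  pose b (k : I * J) := a k.1.
  have us : uniq [seq (i, j) | i <- index_enum I].
    by rewrite map_inj_uniq ?index_enum_uniq// => i i' [].
  have := iid_std_gaussian_linear b (f := fun x => (\1_A x)%:E) iX us.
  rewrite big_map/= a1 sqrtr1.
  under eq_integral do rewrite big_map.
  move=> ->//; last first.
    exact/measurable_EFinP/measurable_indic.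
  transitivity (\int[gauss]_x (\1_A x)%:E).
    by apply: eq_integral => x _; rewrite mul1r.
  by rewrite integral_indic// setIT.
- move=> A mA.
  pose E (s : seq J) : set (#|{: I * J}|.-tuple R) :=
    [set t | forall j, j \in s -> A j (Y (family_of_tuple t) j)].
  have mE s : measurable (E s).
    rewrite (_ : E s = \bigcap_(j in [set` s]) ((Y ^~ j \o family_of_tuple) @^-1` A j)).
      apply: fin_bigcap_measurable; first exact: finite_seq.
      by move=> j _; rewrite -[X in measurable X]setTI; exact: mY.
    by apply/seteqP; split.
  have PE (s : seq J) : uniq s -> P (tuple_of_family X @^-1` E s) =
      \prod_(j <- s) P ((fun w => Y (X ^~ w) j) @^-1` A j).
    elim: s => [_|j s IH /= /andP[js us]].
      rewrite big_nil (_ : _ @^-1` _ = setT) ?probability_setT//.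
      by apply/seteqP; split.
    (* With column [j] moved to the second factor, the event for [j :: s] becomes a rectangle and
       one factor splits off. *)
    have iZ := iid_std_gaussian_mix [pred k : I * J | k.2 == j] iX iX.
    have mEs : measurable (tuple_of_family X @^-1` E s).
      rewrite -[X in measurable X]setTI.
      exact: (measurable_tuple_of_family mX measurableT (mE s)).
    have mYj : measurable ((fun w => Y (X ^~ w) j) @^-1` A j).
      by rewrite -[X in measurable X]setTI; exact: mYX.
    rewrite big_cons -(IH us) muleC -[RHS](prod_probE P P mEs mYj).
    rewrite (iid_std_gaussian_law iX iZ (mE _)).
    congr (prod_prob P P _); apply/seteqP; split => -[u v] /=.
      rewrite /E/= tuple_of_familyK => h; split.
        move=> k ks; rewrite tuple_of_familyK.
        have := h k; rewrite inE ks orbT => /(_ isT); rewrite /Y/=.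
        by rewrite (_ : k == j = false)//; apply/negbTE/eqP => kj; rewrite -kj ks in js.
      by have := h j; rewrite inE eqxx => /(_ isT); rewrite /Y/= eqxx.
    rewrite /E/= !tuple_of_familyK => -[h1 h2] k; rewrite inE => /orP[/eqP ->|ks].
      by rewrite /Y/= eqxx.
    have := h1 k ks; rewrite /Y/=.
    by rewrite (_ : k == j = false)//; apply/negbTE/eqP => kj; rewrite -kj ks in js.
  rewrite -(PE (index_enum J))//; last exact: index_enum_uniq.
  congr (P _); apply/seteqP; split => [w /= h j _|w /= h j _].
    by rewrite tuple_of_familyK; exact: h.
  by have := h j (mem_index_enum _); rewrite tuple_of_familyK.
Qed.

End gaussian_linear_combination.

(** * Maxima of finitely many functions *)

Section positive_part_of_maximum.
Context {R : realType} {V : eqType}.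
Implicit Types (F : seq V) (phi psi h a : V -> R).

(* The starting value 0 plays the role of an extra index at which every
   function vanishes. *)
Definition posmax F phi : R := \big[Num.max/0]_(v <- F) phi v.

Lemma posmax_attained F phi :
  posmax F phi = 0 \/ exists2 v, v \in F & posmax F phi = phi v.
Proof.
rewrite /posmax; elim: F => [|v F IH]; first by left; rewrite big_nil.
rewrite big_cons; case: leP => _.
  by case: IH => [->|[u uF ->]]; [left|right; exists u => //; rewrite inE uF orbT].
by right; exists v => //; rewrite inE eqxx.
Qed.

Lemma posmax_ge0 F phi : 0 <= posmax F phi.
Proof.
rewrite /posmax; elim: F => [|v F IH]; first by rewrite big_nil.
by rewrite big_cons le_max IH orbT.
Qed.

Lemma le_posmax F phi v : v \in F -> phi v <= posmax F phi.
Proof.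
rewrite /posmax; elim: F => [//|u F IH]; rewrite inE big_cons le_max.
by move=> /orP[/eqP ->|/IH ->]; rewrite ?lexx ?orbT.
Qed.

Lemma posmax_le F phi (c : R) : 0 <= c -> (forall v, v \in F -> phi v <= c) ->
  posmax F phi <= c.
Proof. by move=> c0 h; case: (posmax_attained F phi) => [->|[v /h + ->]]. Qed.

Lemma posmaxZ F phi (k : R) : 0 <= k ->
  posmax F (fun v => k * phi v) = k * posmax F phi.
Proof.
move=> k0; apply/eqP; rewrite eq_le; apply/andP; split.
  apply: posmax_le; first by rewrite mulr_ge0// posmax_ge0.
  by move=> v vF; rewrite ler_wpM2l// le_posmax.
case: (posmax_attained F phi) => [->|[v vF ->]].
  by rewrite mulr0 posmax_ge0.
exact: (@le_posmax F (fun v => k * phi v)).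
Qed.

(** Convexity of the maximum: both terms on the right are tested at a maximiser of [h]. *)
Lemma posmax_midpoint F phi psi h :
  (forall v, h v *+ 2 <= phi v + psi v) ->
  posmax F h + posmax F h <= posmax F phi + posmax F psi.
Proof.
move=> hle; case: (posmax_attained F h) => [->|[v vF ->]].
  by rewrite addr0 addr_ge0// posmax_ge0.
by rewrite -mulr2n (le_trans (hle v))// lerD// le_posmax.
Qed.

(* The contraction step: for a symmetric sign, replacing [|a v|] by [a v] can
   only increase the expected maximum. *)
Lemma posmax_contraction F h a :
  posmax F (fun v => h v + `|a v|) + posmax F (fun v => h v - `|a v|) <=
  posmax F (fun v => h v + a v) + posmax F (fun v => h v - a v).
Proof.
set Mp := posmax F (fun v => h v + a v); set Mm := posmax F (fun v => h v - a v).
have hp v : v \in F -> h v + a v <= Mp by exact: (@le_posmax F (fun v => h v + a v)).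
have hm v : v \in F -> h v - a v <= Mm by exact: (@le_posmax F (fun v => h v - a v)).
have p0 : 0 <= Mp := posmax_ge0 _ _.
have m0 : 0 <= Mm := posmax_ge0 _ _.
(* The maximum with [- |a v|] lies below both [Mp] and [Mm]. At a maximiser of the other term, the
   absolute value is [a v] or [- a v], so that term is below one of them and the other remains
   available. *)
have lep : posmax F (fun v => h v - `|a v|) <= Mp.
  apply: posmax_le => // v vF; have := hp v vF.
  by have := ler_norm (- a v); rewrite normrN; lra.
have lem : posmax F (fun v => h v - `|a v|) <= Mm.
  by apply: posmax_le => // v vF; have := hm v vF; have := ler_norm (a v); lra.
have [->|[v vF ->]] := posmax_attained F (fun v => h v + `|a v|).
  by rewrite add0r; lra.
have := hp v vF; have := hm v vF.
by case: (ger0P (a v)) => _ /=; lra.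
Qed.

Lemma measurable_posmax {d} {S : measurableType d} F (phi : V -> S -> R) :
  (forall v, measurable_fun setT (phi v)) ->
  measurable_fun setT (fun s => posmax F (phi ^~ s)).
Proof.
move=> mphi; rewrite /posmax; elim: F => [|v F IH].
  by under eq_fun do rewrite big_nil; exact: measurable_cst.
under eq_fun do rewrite big_cons; exact: measurable_maxr.
Qed.

End positive_part_of_maximum.

(** Halving without subtraction, so that infinite values are covered. *)
Lemma lee_add_self {R : realType} (x y : \bar R) : (x + x <= y + y -> x <= y)%E.
Proof. by apply: contraTT; rewrite -!ltNge => yx; exact: lteD. Qed.

Lemma ge0_integralDT {R : realType} {d} {T : measurableType d}
    (mu : {measure set T -> \bar R}) (f g : T -> \bar R) :
  measurable_fun setT f -> measurable_fun setT g ->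
  (forall x, 0 <= f x)%E -> (forall x, 0 <= g x)%E ->
  (\int[mu]_x (f x + g x) = \int[mu]_x f x + \int[mu]_x g x)%E.
Proof. by move=> mf mg f0 g0; apply: ge0_integralD. Qed.

Lemma ge0_le_integral_shift {R : realType} {d} {T : measurableType d}
    (P : probability T R) (b : R) (phi : T -> R) (G : T -> \bar R) :
  measurable_fun setT phi -> (forall w, 0 <= phi w) ->
  measurable_fun setT G -> (forall w, 0 <= G w)%E ->
  (\int[P]_w (phi w)%:E < +oo)%E ->
  (forall w, (b + phi w)%:E <= G w)%E ->
  (b%:E + \int[P]_w (phi w)%:E <= \int[P]_w G w)%E.
Proof.
move=> mphi phi0 mG G0 phioo bG.
have mphiE : measurable_fun setT (EFin \o phi) by exact/measurable_EFinP.
have [b0|b0] := leP 0 b.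
  rewrite -[b%:E](probability_integral_cst P) -ge0_integralDT//.
  apply: ge0_le_integral_nomeas => w; first by rewrite adde_ge0// lee_fin.
  exact: bG.
(* A negative [b] is moved to the right, so that only nonnegative functions are integrated. *)
have nb0 : 0 <= - b by rewrite oppr_ge0 ltW.
have : (\int[P]_w (phi w)%:E <= \int[P]_w (G w + (- b)%:E))%E.
  apply: ge0_le_integral_nomeas => w; first by rewrite lee_fin.
  have := bG w; rewrite -leeBlDr//.
  by rewrite -EFinB opprK addrC.
rewrite ge0_integralDT//.
rewrite probability_integral_cst -leeBlDr//.
by rewrite -EFinN opprK addeC.
Qed.

(** * Comparison of expected maxima *)

Section gaussian_comparison.
Context {R : realType} {I J : finType} {V : eqType}.
Variables (F : seq V) (e : V -> J -> R).
Notation c := (Num.sqrt (2 / pi) : R).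

Definition row_dot (i : I) (v : V) (x : I * J -> R) : R :=
  \sum_j e v j * x (i, j).

Definition coord_norm (v : V) : R := Num.sqrt (\sum_j e v j ^+ 2).

Lemma family_measurable_row_dot i v : family_measurable (row_dot i v).
Proof.
apply: measurable_sum => j.
by apply: measurable_funM => //; exact: family_measurable_coord.
Qed.

Lemma family_measurable_posmax (phi : V -> (I * J -> R) -> R) :
  (forall v, family_measurable (phi v)) ->
  family_measurable (fun x => (posmax F (phi ^~ x))%:E).
Proof.
move=> mphi; apply/measurable_EFinP.
exact: (@measurable_posmax _ _ _ _ _ (fun v t => phi v (family_of_tuple t))).
Qed.

Lemma measurable_posmax_comp {d} {S : measurableType d} (X : I * J -> S -> R)
    (phi : V -> (I * J -> R) -> R) :
  (forall k, measurable_fun setT (X k)) -> (forall v, family_measurable (phi v)) ->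
  measurable_fun setT (fun w => (posmax F (phi ^~ (X ^~ w)))%:E).
Proof.
move=> mX mphi.
exact: (family_measurable_comp (F := fun x => (posmax F (phi ^~ x))%:E) mX
  (family_measurable_posmax mphi)).
Qed.

Section one_probability_space.
Context {d} {T : measurableType d} (P : probability T R) (X : I * J -> T -> R).
Hypothesis iX : iid_std_gaussian P X.

(** A row applied to a fixed vector is [coord_norm v] times a standard Gaussian, whose absolute mean
    is [c]. *)
Lemma row_dot_abs_mean i v :
  (\int[P]_w (`|row_dot i v (X ^~ w)|)%:E = (c * coord_norm v)%:E)%E.
Proof.
pose b (k : I * J) := e v k.2.
have us : uniq [seq (i, j) | j <- index_enum J].
  by rewrite map_inj_uniq ?index_enum_uniq// => j j' [].
have := iid_std_gaussian_linear b (f := fun x => `|x|%:E) iX us.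
under eq_integral do rewrite big_map.
rewrite /row_dot /b /= => ->//; last first.
  by apply/measurable_EFinP; exact: normr_measurable.
rewrite big_map/= -/(coord_norm v).
under eq_integral do rewrite normrM EFinM.
rewrite ge0_integralZl//; last first.
  by apply/measurable_EFinP; exact: normr_measurable.
by rewrite gauss_abs_mean -EFinM ger0_norm ?sqrtr_ge0// mulrC.
Qed.

Definition mean_posmax (phi : V -> (I * J -> R) -> R) : \bar R :=
  (\int[P]_w (posmax F (phi ^~ (X ^~ w)))%:E)%E.

Lemma mean_posmax_add (phi psi phi' psi' : V -> (I * J -> R) -> R) :
  (forall v, family_measurable (phi v)) -> (forall v, family_measurable (psi v)) ->
  (forall v, family_measurable (phi' v)) -> (forall v, family_measurable (psi' v)) ->
  (forall x, posmax F (phi ^~ x) + posmax F (psi ^~ x) <=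
     posmax F (phi' ^~ x) + posmax F (psi' ^~ x)) ->
  (mean_posmax phi + mean_posmax psi <= mean_posmax phi' + mean_posmax psi')%E.
Proof.
have [mX _ _] := iX.
move=> m1 m2 m3 m4 h.
have m (f : V -> (I * J -> R) -> R) (mf : forall v, family_measurable (f v)) :
    measurable_fun setT (fun w => (posmax F (f ^~ (X ^~ w)))%:E).
  exact: (measurable_posmax_comp mX mf).
have p0 (f : V -> (I * J -> R) -> R) w : (0 <= (posmax F (f ^~ (X ^~ w)))%:E)%E.
  by rewrite lee_fin posmax_ge0.
rewrite /mean_posmax -!ge0_integralDT//; [|exact: m..].
by apply: ge0_le_integral_nomeas => w; rewrite ?adde_ge0// -!EFinD lee_fin h.
Qed.

Section row_step.
Variables (i : I) (h : V -> (I * J -> R) -> R).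
Hypothesis mh : forall v, family_measurable (h v).
Hypothesis h_indep : forall v x x',
  (forall k, k.1 != i -> x k = x' k) -> h v x = h v x'.

(* Jensen: [c * coord_norm v] is the mean of [|row_dot i v|] over an independent copy
   of the i-th row. *)
Lemma mean_posmax_jensen :
  (mean_posmax (fun v x => (h v x + 2 * (c * coord_norm v))%R) <=
   mean_posmax (fun v x => (h v x + `|2 * row_dot i v x|)%R))%E.
Proof.
have [mX _ _] := iX.
pose phi v x := h v x + `|2 * row_dot i v x|.
have mphi v : family_measurable (phi v).
  apply: measurable_funD; first exact: mh.
  apply: measurableT_comp; first exact: normr_measurable.
  by apply: measurable_funM => //; exact: family_measurable_row_dot.
have iZ := iid_std_gaussian_mix [pred k : I * J | k.1 == i] iX iX.
pose Z k (z : T * T) := if k.1 == i then X k z.2 else X k z.1.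
pose G (z : T * T) := ((posmax F (phi ^~ (Z ^~ z)))%:E : \bar R).
have mZ k : measurable_fun setT (Z k).
  by rewrite /Z; case: (k.1 == i); exact: measurableT_comp.
have mG : measurable_fun setT G.
  exact: measurable_posmax_comp.
have G0 z : (0 <= G z)%E by rewrite lee_fin posmax_ge0.
rewrite {2}/mean_posmax.
rewrite (iid_std_gaussian_expectation iX iZ (family_measurable_posmax mphi)); last first.
  by move=> x; rewrite lee_fin posmax_ge0.
rewrite -[leRHS]/(\int[P \x P]_z G z)%E (fubini_tonelli1 G mG G0).
apply: ge0_le_integral_nomeas => u; first by rewrite lee_fin posmax_ge0.
rewrite /fubini_F.
(* With the other rows frozen at [u], only the maximiser [v] matters: its value is the mean over the
   new row of a quantity bounded by the full maximum [G]. *)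
have [->|[v vF ->]] := posmax_attained F
    (fun v => h v (X ^~ u) + 2 * (c * coord_norm v)).
  by apply: integral_ge0 => w _; exact: G0.
have mdot : measurable_fun setT (fun w => `|2 * row_dot i v (X ^~ w)|).
  apply: measurableT_comp; first exact: normr_measurable.
  apply: measurable_funM => //.
  exact: (family_measurable_comp mX (family_measurable_row_dot i v)).
have Edot : (\int[P]_w (`|2 * row_dot i v (X ^~ w)|)%:E =
             (2 * (c * coord_norm v))%:E)%E.
  rewrite EFinM -(row_dot_abs_mean i v) -ge0_integralZl//.
  - by apply: eq_integral => w _; rewrite normrM EFinM ger0_norm.
  - apply/measurable_EFinP; apply: measurableT_comp; first exact: normr_measurable.
    exact: (family_measurable_comp mX (family_measurable_row_dot i v)).
rewrite EFinD -Edot.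
apply: ge0_le_integral_shift => //.
- by apply: measurableT_comp => //.
- by rewrite Edot ltry.
- move=> w; rewrite lee_fin.
  have := @le_posmax _ _ F (phi ^~ (Z ^~ (u, w))) v vF.
  rewrite {1}/phi (@h_indep v _ (X ^~ u)); last first.
    by move=> k ki; rewrite /Z (negbTE ki).
  rewrite (_ : row_dot i v _ = row_dot i v (X ^~ w))//.
  by apply: eq_bigr => j _; rewrite /Z/= eqxx.
Qed.

(** Negating the whole of row [i] preserves the joint law and does not affect [h]. *)
Lemma mean_posmax_flip :
  mean_posmax (fun v x => h v x - 2 * row_dot i v x) =
  mean_posmax (fun v x => h v x + 2 * row_dot i v x).
Proof.
have mdot v : family_measurable (fun x => h v x + 2 * row_dot i v x).
  apply: measurable_funD; first exact: mh.
  by apply: measurable_funM => //; exact: family_measurable_row_dot.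
have iY := iid_std_gaussian_flip [pred k : I * J | k.1 == i] iX.
rewrite [RHS](iid_std_gaussian_expectation iX iY (family_measurable_posmax mdot));
  last first.
  by move=> x; rewrite lee_fin posmax_ge0.
apply: eq_integral => w _; congr EFin; apply: eq_bigr => v _; congr (_ + _).
  by apply: h_indep => k ki /=; rewrite (negbTE ki).
rewrite -mulrN; congr (_ * _); rewrite /row_dot -sumrN; apply: eq_bigr => j _ /=.
by rewrite eqxx mulrN.
Qed.

Lemma mean_posmax_row_step :
  (mean_posmax (fun v x => (h v x + (c * coord_norm v - `|row_dot i v x|))%R) <=
   mean_posmax (fun v x => (h v x + 2 * row_dot i v x)%R))%E.
Proof.
have md v : family_measurable (row_dot i v) by exact: family_measurable_row_dot.
have mad v : family_measurable (fun x => `|row_dot i v x|).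
  by apply: measurableT_comp; [exact: normr_measurable|exact: md].
have m2d v : family_measurable (fun x => 2 * row_dot i v x).
  by apply: measurable_funM => //; exact: md.
have ma2d v : family_measurable (fun x => `|2 * row_dot i v x|).
  by apply: measurableT_comp; [exact: normr_measurable|exact: m2d].
(* The inequality is doubled: twice the left integrand is the sum of [h + 2 * (c * coord_norm v)]
   and [h - |2 * row_dot|]. Jensen treats the first summand, and contraction then removes the
   absolute values from the pair. *)
apply: lee_add_self.
apply: (@le_trans _ _
  (mean_posmax (fun v x => (h v x + 2 * (c * coord_norm v))%R) +
   mean_posmax (fun v x => (h v x - `|2 * row_dot i v x|)%R))%E).
  apply: mean_posmax_add => [v|v|v|v|x].
  - by apply: measurable_funD; [exact: mh|apply: measurable_funB];
      [exact: measurable_cst|exact: mad].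
  - by apply: measurable_funD; [exact: mh|apply: measurable_funB];
      [exact: measurable_cst|exact: mad].
  - by apply: measurable_funD; [exact: mh|exact: measurable_cst].
  - by apply: measurable_funB; [exact: mh|exact: ma2d].
  - apply: posmax_midpoint => v; rewrite normrM [`|2|]ger0_norm//.
    by rewrite -mulr_natl; lra.
apply: (@le_trans _ _
  (mean_posmax (fun v x => (h v x + `|2 * row_dot i v x|)%R) +
   mean_posmax (fun v x => (h v x - `|2 * row_dot i v x|)%R))%E).
  by apply: leeD => //; exact: mean_posmax_jensen.
(* One of the two equal copies on the right gets a minus sign, giving the symmetric pair required by
   contraction. *)
rewrite -[X in (_ <= X + _)%E]mean_posmax_flip [leRHS]addeC.
apply: mean_posmax_add => [v|v|v|v|x].
- by apply: measurable_funD; [exact: mh|exact: ma2d].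
- by apply: measurable_funB; [exact: mh|exact: ma2d].
- by apply: measurable_funD; [exact: mh|exact: m2d].
- by apply: measurable_funB; [exact: mh|exact: m2d].
- exact: posmax_contraction.
Qed.

End row_step.

Lemma mean_posmax_all_rows :
  (mean_posmax (fun v x => (\sum_i (c * coord_norm v - `|row_dot i v x|))%R) <=
   mean_posmax (fun v x => (\sum_i 2 * row_dot i v x)%R))%E.
Proof.
(* Interpolation between the two sides: the rows listed in [s] have already been replaced by their
   linear bound. *)
pose H (s : seq I) i v x := if i \in s then 2 * row_dot i v x
                  else c * coord_norm v - `|row_dot i v x|.
have mH (s : seq I) i v : family_measurable (H s i v).
  rewrite /H; case: (i \in s).
    by apply: measurable_funM => //; exact: family_measurable_row_dot.
  apply: measurable_funB; first exact: measurable_cst.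
  by apply: measurableT_comp; [exact: normr_measurable|exact: family_measurable_row_dot].
suff step (s : seq I) : uniq s ->
    (mean_posmax (fun v x => (\sum_i H [::] i v x)%R) <=
     mean_posmax (fun v x => (\sum_i H s i v x)%R))%E.
  have := step (index_enum I) (index_enum_uniq I).
  rewrite (_ : (fun v x => \sum_i H [::] i v x) =
      (fun v x => \sum_i (c * coord_norm v - `|row_dot i v x|)))//.
  rewrite (_ : (fun v x => \sum_i H (index_enum I) i v x) =
      (fun v x => \sum_i 2 * row_dot i v x))//.
  apply/funext => v; apply/funext => x; apply: eq_bigr => i _.
  by rewrite /H mem_index_enum.
elim: s => [//|i s IH] /= /andP[nis us]; apply: le_trans (IH us) _.
pose h v x := \sum_(i' | i' != i) H s i' v x.
have mh v : family_measurable (h v).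
  rewrite /h /family_measurable.
  rewrite (_ : _ \o _ = (fun t => \sum_(i' <- [seq i' <- index_enum I | i' != i])
      H s i' v (family_of_tuple t))).
    by apply: measurable_sum => i'; exact: mH.
  by apply/funext => t /=; rewrite big_filter.
have hi v x x' : (forall k : I * J, k.1 != i -> x k = x' k) -> h v x = h v x'.
  move=> xx'; apply: eq_bigr => i' i'i.
  have E : row_dot i' v x = row_dot i' v x'.
    by apply: eq_bigr => j _; rewrite xx'.
  by rewrite /H E.
have := mean_posmax_row_step mh hi.
rewrite (_ : (fun v x => h v x + (_ - _)) = (fun v x => \sum_i' H s i' v x)); last first.
  apply/funext => v; apply/funext => x; rewrite (bigD1 i)//= addrC.
  by rewrite {2}/H (negbTE nis).
rewrite (_ : (fun v x => h v x + _ * _) = (fun v x => \sum_i' H (i :: s) i' v x))//.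
apply/funext => v; apply/funext => x; rewrite (bigD1 i)//= addrC.
rewrite {2}/H mem_head; congr (_ + _); apply: eq_bigr => i' /negbTE i'i.
by rewrite /H inE i'i.
Qed.

End one_probability_space.

Lemma gaussian_posmax_comparison {d1} {T1 : measurableType d1}
    (P : probability T1 R) (X : I * J -> T1 -> R)
    {d2} {T2 : measurableType d2} (Q : probability T2 R) (g : J -> T2 -> R) :
  (0 < #|I|)%N -> iid_std_gaussian P X -> iid_std_gaussian Q g ->
  (\int[P]_w (posmax F (fun v =>
       (\sum_i (c * coord_norm v - `|row_dot i v (X ^~ w)|))%R))%:E <=
   (2 * Num.sqrt #|I|%:R)%:E *
     \int[Q]_w (posmax F (fun v => (\sum_j e v j * g j w)%R))%:E)%E.
Proof.
move=> I0 iX ig.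
apply: (le_trans (mean_posmax_all_rows iX)).
(* The sum of the rows is [r] times the standard Gaussian vector with weights [r^-1]; this is the
   source of the factor [Num.sqrt #|I|%:R]. *)
pose r : R := Num.sqrt #|I|%:R.
have r0 : 0 < r by rewrite sqrtr_gt0 ltr0n.
have iY : iid_std_gaussian P (fun j w => \sum_(i : I) r^-1 * X (i, j) w).
  apply: (iid_std_gaussian_columns (a := fun=> r^-1) iX).
  rewrite sumr_const -mulr_natl exprVn sqr_sqrtr ?ler0n// divff//.
  by rewrite pnatr_eq0 -lt0n.
pose L (x : J -> R) := ((posmax F (fun v => \sum_j e v j * x j))%:E : \bar R).
have mL : family_measurable L.
  apply/measurable_EFinP.
  apply: (@measurable_posmax _ _ _ _ _ (fun v t => \sum_j e v j * family_of_tuple t j)).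
  move=> v; apply: measurable_sum => j; apply: measurable_funM => //.
  exact: family_measurable_coord.
have L0 x : (0 <= L x)%E by rewrite lee_fin posmax_ge0.
rewrite -[X in (_ * X)%E]/(\int[Q]_w L (g ^~ w))%E.
rewrite -(iid_std_gaussian_expectation iY ig mL L0).
have [mY _ _] := iY.
rewrite -ge0_integralZl//; last first.
  exact: (family_measurable_comp (F := L) mY mL).
apply: ge0_le_integral_nomeas => w; first by rewrite lee_fin posmax_ge0.
rewrite -EFinM lee_fin -posmaxZ; last by rewrite mulr_ge0// ltW.
rewrite le_eqVlt; apply/orP; left; apply/eqP; apply: eq_bigr => v _.
rewrite -mulr_sumr -mulrA; congr (_ * _).
rewrite exchange_big/= mulr_sumr; apply: eq_bigr => j _.
rewrite -[in RHS]mulr_sumr mulrCA [r * _]mulrA divff ?gt_eqF// mul1r.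
by rewrite mulr_sumr.
Qed.

End gaussian_comparison.

(** * From finite maxima to suprema *)

Lemma continuous_sumr {R : realType} {T : topologicalType} {I : Type} (s : seq I)
    (f : I -> T -> R) :
  (forall i, continuous (f i)) -> continuous (fun x => \sum_(i <- s) f i x).
Proof.
move=> cf; apply: continuous_big => [x|i _]; last exact: cf.
exact: add_continuous.
Qed.

(** Rational points need not lie in [T], so for each rational centre and each radius [1 / (m + 1)] a
    nearby point of [T] is chosen whenever there is one, with [u0] as default. *)
Lemma sequence_dense_in_set {R : realType} (p : nat) (T : set 'cV[R]_p) (u0 : 'cV[R]_p) :
  T u0 ->
  exists2 s : nat -> 'cV[R]_p, (forall k, T (s k)) &
    forall u U, T u -> nbhs u U -> exists k, U (s k).
Proof.
move=> Tu0.
pose Q (x : 'cV[rat]_p * nat) : set 'cV[R]_p :=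
  T `&` [set u | forall i j, `|ratr (x.1 i j) - u i j| < x.2.+1%:R^-1].
pose s k := if unpickle k is Some x then xget u0 (Q x) else u0.
exists s => [k|u U Tu].
  rewrite /s; case: unpickle => // x.
  by case: xgetP => [v _ [Tv _]|_].
move=> /nbhs_ballP[eps /= eps0 epsU].
(* The radius is below [eps / 2] because [u] and the chosen point are compared through their common
   rational centre. *)
have /ltr_add_invr[m] : 0 < eps / 2 by rewrite divr_gt0.
rewrite add0r => hm.
have hr (i : 'I_p) (j : 'I_1) : {r : rat | `|ratr r - u i j| < m.+1%:R^-1}.
  have : u i j - m.+1%:R^-1 < u i j + m.+1%:R^-1.
    by rewrite ltrBlDr -addrA ltrDl addr_gt0.
  move=> /rat_in_itvoo/cid[r]; rewrite in_itv/= => /andP[r1 r2]; exists r.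
  by rewrite distrC ltr_distlC r1 r2.
pose r : 'cV[rat]_p := \matrix_(i, j) sval (hr i j).
exists (pickle (r, m)); rewrite /s pickleK.
have Qu : Q (r, m) u by split => // i j; rewrite mxE; exact: (svalP (hr i j)).
case: xgetP => [v _ [_ /= hv]|/(_ u)//].
apply: epsU; split => // i j; rewrite /ball/=.
have := hv i j; have := Qu.2 i j => /=.
set a := ratr _; set b := m.+1%:R^-1 in hm *.
by rewrite !ltr_norml => /andP[? ?] /andP[? ?]; apply/andP; split; lra.
Qed.

(** * The excess and its continuity in the vector *)

Section excess.
Context {R : realType} {n q p : nat} (C : 'M[R]_(q, p)).

Definition image_coord (u : 'cV[R]_p) (j : 'I_q) : R := (C *m u) j ord0.

Lemma coord_norm_image u :
  coord_norm image_coord u = Num.sqrt ((u^T *m C^T *m C *m u) ord0 ord0).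
Proof.
rewrite /coord_norm; congr Num.sqrt.
rewrite -trmx_mul -mulmxA mxE; apply: eq_bigr => j _.
by rewrite mxE expr2.
Qed.

Lemma row_dot_image (u : 'cV[R]_p) (x : 'I_n * 'I_q -> R) i :
  row_dot image_coord i u x = ((\matrix_(i, j) x (i, j)) *m C *m u) i ord0.
Proof.
by rewrite -mulmxA mxE; apply: eq_bigr => j _; rewrite mxE mulrC.
Qed.

Lemma inner_image (u : 'cV[R]_p) (x : 'I_q -> R) :
  \sum_j image_coord u j * x j = ((C^T *m \col_k x k)^T *m u) ord0 ord0.
Proof.
rewrite trmx_mul trmxK -mulmxA mxE; apply: eq_bigr => j _.
by rewrite mulrC /image_coord; congr (_ * _); rewrite !mxE.
Qed.

(* [n] times the amount by which [|A u|_1 / n] falls short of its expectation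
   [sqrt (2 / pi) * |C u|]. *)
Definition excess (x : 'I_n * 'I_q -> R) (u : 'cV[R]_p) : R :=
  \sum_i (Num.sqrt (2 / pi) * coord_norm image_coord u
          - `|row_dot image_coord i u x|).

Lemma continuous_image_coord j : continuous (image_coord ^~ j).
Proof.
rewrite /image_coord.
rewrite (_ : (fun _ => _) = (fun u : 'cV[R]_p => \sum_k C j k * u k ord0)); last first.
  by apply/funext => v; rewrite mxE.
apply: continuous_sumr => k u.
apply: (@continuousM _ _ (fun=> C j k) (fun u : 'cV[R]_p => u k ord0)).
  exact: cst_continuous.
exact: coord_continuous.
Qed.

Lemma continuous_excess x : continuous (excess x).
Proof.
rewrite /excess; apply: continuous_sumr => i u.
apply: (@continuousB _ _ _ (fun u => Num.sqrt (2 / pi) * coord_norm image_coord u)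
   (fun u => `|row_dot image_coord i u x|)).
  apply: (@continuousM _ _ (fun=> Num.sqrt (2 / pi)) (coord_norm image_coord)).
    exact: cst_continuous.
  apply: (@continuous_comp _ _ _ (fun u => \sum_j image_coord u j ^+ 2) Num.sqrt);
    last exact: sqrt_continuous.
  apply: (@continuous_sumr _ _ _ _ (fun j u => image_coord u j ^+ 2)) => j v.
  by apply: continuousM; exact: continuous_image_coord.
apply: (@continuous_comp _ _ _ (fun u => row_dot image_coord i u x) Num.norm);
  last exact: norm_continuous.
apply: (@continuous_sumr _ _ _ _ (fun j u => image_coord u j * x (i, j))) => j v.
apply: (@continuousM _ _ (image_coord ^~ j) (fun=> x (i, j))).
  exact: continuous_image_coord.
exact: cst_continuous.
Qed.

End excess.

Lemma sup_or0_ge0 {R : realType} (S : set R) : (0 <= sup_or0 S)%E.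
Proof. by apply: ereal_sup_ubound; left. Qed.

Lemma le_sup_or0 {R : realType} (S : set R) x : S x -> (x%:E <= sup_or0 S)%E.
Proof. by move=> Sx; apply: ereal_sup_ubound; right; exists x. Qed.

Lemma sup_or0_le {R : realType} (S : set R) (M : \bar R) :
  (0 <= M)%E -> (forall x, S x -> (x%:E <= M)%E) -> (sup_or0 S <= M)%E.
Proof. by move=> M0 SM; apply: ge_ereal_sup => _ [->//|[x Sx <-]]; exact: SM. Qed.

Lemma posmax_subset {R : realType} {V : eqType} (F G : seq V) (phi : V -> R) :
  {subset F <= G} -> posmax F phi <= posmax G phi.
Proof.
move=> FG; apply: posmax_le; first exact: posmax_ge0.
by move=> v /FG; exact: le_posmax.
Qed.

(** * A measurable majorant of the excess over the whole set *)

Section excess_expectation.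
Context {R : realType} {n q p : nat} (C : 'M[R]_(q, p)).
Local Open Scope ereal_scope.

Lemma measurable_excess u : family_measurable (fun x : 'I_n * 'I_q -> R => excess C x u).
Proof.
apply: measurable_sum => i; apply: measurable_funB; first exact: measurable_cst.
by apply: measurableT_comp; [exact: normr_measurable|exact: family_measurable_row_dot].
Qed.

Lemma ex_measurable_excess_bound (T : set 'cV[R]_p)
    {d1} {Omega1 : measurableType d1} (P : probability Omega1 R)
    (X : 'I_n * 'I_q -> Omega1 -> R)
    {d2} {Omega2 : measurableType d2} (Q : probability Omega2 R)
    (g : 'I_q -> Omega2 -> R) :
  (0 < n)%N -> iid_std_gaussian P X -> iid_std_gaussian Q g ->
  exists S : Omega1 -> \bar R,
    [/\ measurable_fun setT S, (forall w, 0 <= S w),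
        (forall w u, T u -> (excess C (X ^~ w) u)%:E <= S w) &
        \int[P]_w S w <= (2 * Num.sqrt n%:R)%:E *
          \int[Q]_w sup_or0 [set `|((C^T *m \col_k g k w)^T *m u) ord0 ord0|%R | u in T]].
Proof.
move=> n0 iX ig; have [mX _ _] := iX.
(* Adjoining 0 provides a base point even for empty [T]; it is harmless on the Gaussian side, where
   its inner product is 0. *)
have [s sT sdense] := @sequence_dense_in_set R p (0%R |` T) 0%R (or_introl erefl).
pose F k := [seq s i | i <- iota 0 k].
pose K k w := (posmax (F k) (excess C (X ^~ w)))%:E.
pose S w := ereal_sup (range (K ^~ w)).
have K0 k w : 0 <= K k w by rewrite lee_fin posmax_ge0.
have ndK w : nondecreasing_seq (K ^~ w).
  move=> k l kl; rewrite lee_fin; apply: posmax_subset => v /mapP[i].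
  rewrite mem_iota add0n => /andP[_ ik] ->; apply: map_f.
  by rewrite mem_iota add0n (leq_trans ik).
have mK k : measurable_fun setT (K k).
  apply: (@measurable_posmax_comp _ _ _ _ _ _ _ X (fun u x => excess C x u) mX).
  exact: measurable_excess.
have cvgK w : K ^~ w @ \oo --> S w by exact: ereal_nondecreasing_cvgn.
have leS k w : K k w <= S w by apply: ereal_sup_ubound; exists k.
have S0 w : 0 <= S w := le_trans (K0 0%N w) (leS 0%N w).
exists S; split => //.
- by apply: emeasurable_fun_cvg mK _ => w _; exact: cvgK.
(* By continuity some [s k] has excess above that of [u] minus [eps]. It first occurs in [F k.+1],
   since [F k] stops at index [k - 1]. *)
- move=> w u Tu; apply/lee_addgt0Pr => eps eps0.
  have /= := @continuous_excess R n q p C (X ^~ w) u.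
  move=> /cvgr_gt -/(_ (excess C (X ^~ w) u - eps)%R).
  rewrite ltrBlDr ltrDl => /(_ eps0) near_u.
  have [k hk] := sdense u _ (or_intror Tu) near_u.
  apply: (@le_trans _ _ (K k.+1 w + eps%:E)); last by rewrite leeD2r.
  rewrite -EFinD lee_fin -lerBlDr (le_trans (ltW hk))//.
  by apply: le_posmax; apply: map_f; rewrite mem_iota/=.
- have -> : \int[P]_w S w = limn (fun k => \int[P]_w K k w).
    rewrite -monotone_convergence//.
    by apply: eq_integral => w _; apply/esym/cvg_lim => //; exact: cvgK.
  apply: lime_le.
    apply: ereal_nondecreasing_is_cvgn => k l kl.
    by apply: ge0_le_integral_nomeas => // w; exact: ndK.
  apply: nearW => k.
  apply: (le_trans (gaussian_posmax_comparison (F k) (image_coord C) _ iX ig)).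
    by rewrite card_ord.
  rewrite card_ord lee_wpmul2l// ?lee_fin ?mulr_ge0//.
  apply: ge0_le_integral_nomeas => w; first by rewrite lee_fin posmax_ge0.
  have [->|[v /mapP[i _ ->] ->]] := posmax_attained (F k)
    (fun v => \sum_j image_coord C v j * g j w)%R; first exact: sup_or0_ge0.
  rewrite inner_image.
  have [->|Tsi] := sT i; first by rewrite mulmx0 mxE sup_or0_ge0.
  apply: le_trans (le_sup_or0 _); last by exists (s i).
  by rewrite lee_fin ler_norm.
Qed.

End excess_expectation.

(** * From the excess bound to the estimate on [Teps] *)

Theorem theorem5 (R : realType) (n q p : nat) (hn : (0 < n)%N)
  (T : set 'cV[R]_p) (hT : bounded_set T)
  (C : 'M[R]_(q, p)) (eps : R) (heps : 0 <= eps)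
  (d1 : measure_display) (Omega1 : measurableType d1) (P1 : probability Omega1 R)
  (Bent : 'I_n * 'I_q -> Omega1 -> R) (hB : iid_std_gaussian P1 Bent)
  (d2 : measure_display) (Omega2 : measurableType d2) (P2 : probability Omega2 R)
  (gent : 'I_q -> Omega2 -> R) (hg : iid_std_gaussian P2 gent) :
  let B (w : Omega1) : 'M[R]_(n, q) := \matrix_(i, j) Bent (i, j) w in
  let A (w : Omega1) : 'M[R]_(n, p) := B w *m C in
  let Teps (w : Omega1) : set 'cV[R]_p :=
    [set u | T u /\ n%:R^-1 * l1norm (A w *m u) <= eps] in
  let g (w : Omega2) : 'cV[R]_q := \col_k gent k w in
  (\int[P1]_w @sup_or0 R [set Num.sqrt ((u^T *m C^T *m C *m u) ord0 ord0) | u in Teps w]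
   <= (Num.sqrt (2 * pi / n%:R))%:E *
        \int[P2]_w @sup_or0 R [set (`|((C^T *m g w)^T *m u) ord0 ord0|)%R | u in T]
      + (Num.sqrt (pi / 2) * eps)%:E)%E.
Proof.
cbv zeta.
set Teps := fun w : Omega1 => [set u | T u /\ _].
set g := fun w : Omega2 => \col_k gent k w.
have [S [mS S0 SD SE]] := ex_measurable_excess_bound C T hn hB hg.
have n0 : 0 < n%:R :> R by rewrite ltr0n.
pose c2 : R := Num.sqrt (pi / 2).
pose I := (\int[P2]_w @sup_or0 R
  [set (`|((C^T *m g w)^T *m u) ord0 ord0|)%R | u in T])%E.
have c20 : 0 <= c2 by rewrite sqrtr_ge0.
(* [c2] is the inverse of the Gaussian absolute mean; it turns the scaled norm back into the norm of
   [C u]. *)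
have cc : c2 * Num.sqrt (2 / pi) = 1.
  rewrite -sqrtrM ?divr_ge0 ?pi_ge0// mulrA divfK//.
  by rewrite divff ?sqrtr1// gt_eqF// pi_gt0.
(* For [u] in [Teps w], the scaled norm equals [|A u|_1 / n] plus [excess / n], hence is at most
   [eps + S w / n]. *)
have leL w : (@sup_or0 R [set Num.sqrt ((u^T *m C^T *m C *m u) ord0 ord0) | u in Teps w]
    <= c2%:E * (eps%:E + n%:R^-1%:E * S w))%E.
  apply: sup_or0_le => [|_ [u [Tu hu] <-]].
    by rewrite mule_ge0 ?adde_ge0 ?mule_ge0 ?lee_fin// invr_ge0 ltW.
  rewrite -coord_norm_image (_ : coord_norm _ u =
    c2 * (Num.sqrt (2 / pi) * coord_norm (image_coord C) u)); last first.
    by rewrite mulrA cc mul1r.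
  rewrite EFinM.
  apply: lee_wpmul2l; first by rewrite lee_fin.
  apply: (@le_trans _ _ (eps%:E + n%:R^-1%:E * (excess C (Bent ^~ w) u)%:E)%E); last first.
    apply: leeD => //; apply: lee_wpmul2l; first by rewrite lee_fin invr_ge0 ltW.
    exact: SD.
  rewrite -EFinM -EFinD lee_fin.
  rewrite /excess sumrB sumr_const card_ord mulrBr.
  rewrite -[X in _ * X - _]mulr_natl mulKf ?gt_eqF//.
  rewrite addrCA lerDl subr_ge0 (le_trans _ hu)// /l1norm.
  by under eq_bigr do rewrite row_dot_image.
have cI : c2 * n%:R^-1 * (2 * Num.sqrt n%:R) = Num.sqrt (2 * pi / n%:R).
  apply/eqP; rewrite -(@eqrXn2 _ 2)// ?sqrtr_ge0//; last first.
    by rewrite !mulr_ge0// ?invr_ge0 ?ltW// sqrtr_ge0.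
  rewrite sqr_sqrtr; last by rewrite !mulr_ge0// ?pi_ge0// invr_ge0 ltW.
  rewrite !exprMn !sqr_sqrtr ?divr_ge0 ?pi_ge0 ?ler0n//.
  apply/eqP; have n00 : n%:R != 0 :> R by rewrite gt_eqF.
  by field.
(* The random supremum is replaced by a measurable majorant before the integral is split by
   linearity. *)
apply: (@le_trans _ _ (\int[P1]_w (c2%:E * (eps%:E + n%:R^-1%:E * S w)))%E).
  by apply: ge0_le_integral_nomeas => [w|]; [exact: sup_or0_ge0|exact: leL].
have mnS : measurable_fun setT (fun w => n%:R^-1%:E * S w)%E.
  exact: measurable_funeM.
have nS0 w : (0 <= n%:R^-1%:E * S w)%E by rewrite mule_ge0// lee_fin invr_ge0 ltW.
rewrite ge0_integralZl//; last 2 first.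
- exact: emeasurable_funD.
- by move=> w _; rewrite adde_ge0// lee_fin.
rewrite ge0_integralDT//.
rewrite probability_integral_cst ge0_integralZl//.
rewrite -/I.
have intS0 : (0 <= \int[P1]_w S w)%E by apply: integral_ge0.
rewrite ge0_muleDr ?lee_fin//; last by rewrite mule_ge0// lee_fin invr_ge0 ltW.
rewrite addeC -EFinM; apply: leeD => //.
rewrite muleA -EFinM -cI [in leRHS]EFinM -muleA.
by apply: lee_wpmul2l; rewrite ?lee_fin ?mulr_ge0 ?invr_ge0// ltW.
Qed.
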